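(* For all positive integers $n,p$, $\mathtt{SS}(n,p)=\Omega\left(\dfrac{\beta(n,p,\infty)}{p}\right)$.
   Context: For a directed graph $G=(V,E)$, a $\Delta$-diameter-reducing shortcut set is a set $H$ of additional directed edges, each in the transitive closure of $G$, such that for all $s,t\in V$ for which $G$ has an $s\leadsto t$ path, $\mathrm{dist}_{G\cup H}(s,t)\le\Delta$ (unweighted hop distance). $\mathtt{SS}(n,p)$ is the smallest integer $\Delta$ such that every $n$-node directed graph has a $\Delta$-diameter-reducing shortcut set of $|H|=p$ edges. A path system is $S=(V,\Pi)$ with $V$ a finite set of nodes and $\Pi$ a multiset of node sequences (paths), each containing each node at most once; size $\|S\|=\sum_\pi|\pi|$ ($|\pi|$ = number of nodes). Write $x<_\pi y$ if $x$ strictly precedes $y$ in $\pi$. A $b$-bridge: $b$ distinct nodes $v_1,\dots,v_b$ and $b$ distinct paths $\pi_1,\dots,\pi_b$ with $v_i<_{\pi_i}v_{i+1}$ ($1\le i\le b-1$) and $v_1<_{\pi_b}v_b$. Bridge girth = least $b$ admitting a $b$-bridge ($\infty$ if none). $\beta(n,p,k)$ = maximum size of a path system with $n$ nodes, $p$ paths and bridge girth $>k$.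
   Formalization: SS(n,p) is taken with |H| ≤ p, since with |H| = p it is undefined (an edgeless graph admits no shortcut edges), and Ω is read with a constant c > 0 for all n above a threshold N and all p ≥ 1, since at n = 1 the bound fails (SS(1,p) = 0, β(1,p,∞) = p). *)

(* Defs.v *)
From mathcomp Require Import all_boot.
From mathcomp Require Import boolp.

Set Implicit Arguments.
Unset Strict Implicit.
Unset Printing Implicit Defensive.

Definition tclosure n (E : rel 'I_n) (u v : 'I_n) : bool :=
  [exists w, E u w && connect E w v].

Definition union_graph n (E : rel 'I_n) (H : {set 'I_n * 'I_n}) : rel 'I_n :=
  fun u v => E u v || ((u, v) \in H).

Definition dist_le n (G : rel 'I_n) (s t : 'I_n) (D : nat) : Prop :=
  exists q : seq 'I_n, [/\ size q <= D, path G s q & last s q = t].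

Definition diam_reducing_shortcut n (E : rel 'I_n) (H : {set 'I_n * 'I_n})
    (D : nat) : Prop :=
  (forall e, e \in H -> tclosure E e.1 e.2) /\
  (forall s t, connect E s t -> dist_le (union_graph E H) s t D).

Definition SS_ok (n p D : nat) : Prop :=
  forall E : rel 'I_n, exists H : {set 'I_n * 'I_n},
    #|H| <= p /\ diam_reducing_shortcut E H D.

Lemma SS_ok_n (n p : nat) : SS_ok n p n.
Proof.
move=> E; exists set0; rewrite cards0; split=> //; split=> [e|s t].
  by rewrite in_set0.
move=> /connectP [q pq ->]; case: (shortenP pq) => q' pq' uq _.
exists q'; split=> //.
  have /card_uniqP /= Hc := uq.
  apply: leq_trans (leqnSn _) _; rewrite -Hc.
  by apply: leq_trans (max_card _) _; rewrite card_ord.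
by apply: sub_path pq' => u v /=; rewrite /union_graph => ->.
Qed.

Lemma SS_ex (n p : nat) : exists D, `[< SS_ok n p D >].
Proof. by exists n; apply/asboolP; apply: SS_ok_n. Qed.

Definition SS (n p : nat) : nat := ex_minn (SS_ex n p).

(* Path systems on the node set 'I_n with p paths (a multiset of paths *)
(* is represented as a family indexed by 'I_p).                        *)

Definition path_system n p := 'I_p -> seq 'I_n.

Definition ps_valid n p (S : path_system n p) : Prop := forall i, uniq (S i).

Definition ps_size n p (S : path_system n p) : nat := \sum_(i < p) size (S i).

Definition prec n (s : seq 'I_n) (x y : 'I_n) : bool :=
  [&& x \in s, y \in s & index x s < index y s].

Definition bridge n p (S : path_system n p) (b : nat) : Prop :=
  exists (v : 'I_b -> 'I_n) (pi : 'I_b -> 'I_p),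
    [/\ 0 < b, injective v, injective pi,
        (forall i j : 'I_b, j = i.+1 :> nat -> prec (S (pi i)) (v i) (v j)) &
        (forall i0 il : 'I_b, i0 = 0 :> nat -> il = b.-1 :> nat ->
           prec (S (pi il)) (v i0) (v il))].

(* bridge girth > k, where k = None stands for infinity *)
Definition girth_gt n p (S : path_system n p) (k : option nat) : Prop :=
  forall b, (if k is Some k' then b <= k' else true) -> ~ bridge S b.

Definition beta_ok (n p : nat) (k : option nat) (m : nat) : Prop :=
  exists S : path_system n p, [/\ ps_valid S, girth_gt S k & ps_size S = m].

Lemma beta_ex (n p : nat) (k : option nat) : exists m, `[< beta_ok n p k m >].
Proof.
exists 0; apply/asboolP; exists (fun _ => [::]); split.
- by [].
- move=> b _ [v [pi [+ _ _ _ Hl]]].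
  case: b v pi Hl => [|b] v pi Hl // _.
  by have := Hl ord0 ord_max erefl erefl.
- by rewrite /ps_size big1.
Qed.

Lemma beta_ub (n p : nat) (k : option nat) :
  forall m, `[< beta_ok n p k m >] -> m <= p * n.
Proof.
move=> m /asboolP [S [vS _ <-]].
rewrite /ps_size -[p in p * n]card_ord -sum_nat_const.
apply: leq_sum => i _; have /card_uniqP <- := vS i.
by apply: leq_trans (max_card _) _; rewrite card_ord.
Qed.

Definition beta (n p : nat) (k : option nat) : nat :=
  ex_maxn (beta_ex n p k) (@beta_ub n p k).

(* Main.v *)
Require Import Defs.
From mathcomp Require Import all_boot all_algebra.
From mathcomp Require Import boolp zify.
Import GRing.Theory Num.Theory.

Set Implicit Arguments.
Unset Strict Implicit.
Unset Printing Implicit Defensive.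

(* Let S be a bridge-free path system. Follow immediate successors along
   pairwise distinct paths through pairwise distinct nodes until this is no
   longer possible: bridge-freeness shows that the end of such a maximal chain
   is a non-final node of at most three paths. Removing such a node from the
   paths where it is not final, and recursing on the remaining nodes, costs at
   most 3n in total size and leaves a bridge-free system T whose paths all
   increase some rank function.

   In the graph G of consecutive pairs of T, every walk between two nodes of a
   path of T stays on that path. Hence a shortcut edge is useful inside at most
   one path, and each block of D + 2 consecutive nodes of a path must contain
   its own shortcut if the diameter is to become D. With p shortcuts this gives
   |T| <= 2p(D + 2). The same bound applied to a partition of the nodes into p
   increasing paths gives n <= 2p(D + 2), so that beta <= 8p(D + 2) <= 24pD. *)

(** * Order along a path, and bridges *)

Definition follows n (s : seq 'I_n) (x y : 'I_n) : bool :=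
  [&& x \in s, y \in s & index y s == (index x s).+1].

Definition nonlast n (s : seq 'I_n) (x : 'I_n) : bool :=
  (x \in s) && ((index x s).+1 < size s).

Lemma follows_prec n (s : seq 'I_n) x y : follows s x y -> prec s x y.
Proof. by case/and3P=> xs ys /eqP e; rewrite /prec xs ys e leqnn. Qed.

Lemma nonlast_follows n (s : seq 'I_n) x :
  uniq s -> nonlast s x -> exists y, follows s x y.
Proof.
move=> us /andP[xs lt]; exists (nth x s (index x s).+1).
by rewrite /follows xs mem_nth // index_uniq // eqxx.
Qed.

Lemma prec_cons n (s : seq 'I_n) a x y : a \notin s ->
  prec (a :: s) x y = ((x == a) && (y \in s)) || prec s x y.
Proof.
move=> as_; rewrite /prec !inE /= [a == x]eq_sym [a == y]eq_sym.
have [->|xa] := eqVneq x a; have [->|ya] := eqVneq y a;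
  by rewrite ?(negbTE as_) ?andbF ?andbT ?orbF ?orbT /= ?ltn0 ?ltnS ?andbF.
Qed.

Lemma prec_subseq n (s t : seq 'I_n) x y :
  uniq t -> subseq s t -> prec s x y -> prec t x y.
Proof.
elim: t s => [|b t IH] [|a s] //= /andP[bt ut].
case: eqP => [->|_] sub.
  have sb : b \notin s by apply: contra bt; apply: (mem_subseq sub).
  rewrite !prec_cons // => /orP[/andP[-> /(mem_subseq sub)->] //|/(IH _ ut sub)->].
  by rewrite orbT.
by move=> /(IH _ ut sub); rewrite prec_cons // => ->; rewrite orbT.
Qed.

(** Sequences over [nat] are constrained only below [b], so bridges can be built by shifting and
    splicing indices without ordinal casts. *)
Lemma bridge_nat n p (S : path_system n p) (b : nat)
    (v : nat -> 'I_n) (s : nat -> 'I_p) :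
  0 < b ->
  (forall i j, i < b -> j < b -> v i = v j -> i = j) ->
  (forall i j, i < b -> j < b -> s i = s j -> i = j) ->
  (forall j, j.+1 < b -> prec (S (s j)) (v j) (v j.+1)) ->
  prec (S (s b.-1)) (v 0) (v b.-1) -> bridge S b.
Proof.
move=> b0 iv is_ st cl; exists (fun i => v (nat_of_ord i)), (fun i => s (nat_of_ord i)).
split=> // [i j e|i j e|i j e|i j /= -> -> //].
- exact/val_inj/(iv _ _ (ltn_ord i) (ltn_ord j)).
- exact/val_inj/(is_ _ _ (ltn_ord i) (ltn_ord j)).
- by rewrite /= e; apply: st; rewrite -e.
Qed.

(** Two distinct paths through the same ordered pair form a 2-bridge. *)
Lemma two_paths_no_common_pair n p (S : path_system n p) i j x y :
  girth_gt S None -> prec (S i) x y -> prec (S j) x y -> i = j.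
Proof.
move=> g px py; have [//|ij] := eqVneq i j; exfalso.
have xy : x <> y by move=> e; move: px; rewrite /prec e ltnn !andbF.
apply: (g 2 isT).
apply: (@bridge_nat _ _ _ _ (fun k => if k is 0 then x else y)
                            (fun k => if k is 0 then i else j)) => //.
- by move=> [|[|k]] [|[|l]] //= _ _ e; case: xy.
- by move=> [|[|k]] [|[|l]] //= _ _ e; rewrite e eqxx in ij.
- by move=> [|[|k]].
Qed.

(** * Chains of immediate successors and the exits from their end *)

(** There are [k] steps and [k.+1] nodes, with end [v k]. Steps go to immediate successors, so no
    node of [S (s j)] lies strictly between [v j] and [v j.+1]. *)
Definition chain n p (S : path_system n p) (k : nat)
    (v : nat -> 'I_n) (s : nat -> 'I_p) : Prop :=
  [/\ forall i j, i <= k -> j <= k -> v i = v j -> i = j,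
      forall i j, i < k -> j < k -> s i = s j -> i = j &
      forall j, j < k -> follows (S (s j)) (v j) (v j.+1)].

(** Otherwise [t] from [v k] to [v i], then the chain up to [v i'], closed by [t'], is a bridge. *)
Lemma exit_labels_outside n p (S : path_system n p) k v s t t' i i' :
  girth_gt S None -> chain S k v s -> i <= i' < k ->
  (forall j, j < k -> s j <> t) -> (forall j, j < k -> s j <> t') ->
  prec (S t) (v k) (v i) -> prec (S t') (v k) (v i') -> t = t'.
Proof.
move=> g [iv is_ st] /andP[ii' i'k] nt nt' pt pt'.
have [//|tt'] := eqVneq t t'; exfalso.
apply: (g (i' - i).+2 isT).
apply: (@bridge_nat _ _ _ _
  (fun j => if j is j'.+1 then v (i + j') else v k)
  (fun j => if j is j'.+1 then if j' < i' - i then s (i + j') else t' else t)).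
- by [].
- move=> [|a] [|b] /= ha hb // /iv e;
    by first [lia | have := e ltac:(lia) ltac:(lia); lia].
- move=> [|a] [|b] //= ha hb.
  + case: ifP => hb' e; first by case: (nt (i + b)); [lia|].
    by rewrite e eqxx in tt'.
  + case: ifP => ha' e; first by case: (nt (i + a)); [lia|].
    by rewrite e eqxx in tt'.
  + case: ifP => ha'; case: ifP => hb' e; try lia.
    * by have := is_ _ _ _ _ e; lia.
    * by case: (nt' (i + a)); [lia|].
    * by case: (nt' (i + b)); [lia|].
- move=> [|a] /= ha; first by rewrite addn0.
  have -> : a < i' - i by lia.
  by rewrite addnS; apply/follows_prec/st; lia.
- by rewrite /= ltnn subnKC.
Qed.

(** If [v k] came after [v i] on [S (s i)], it would come after the immediate successor [v i.+1],
    and [s i] would close the chain from [v i.+1] to [v k] into a bridge. *)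
Lemma exit_label_inside n p (S : path_system n p) k v s i :
  girth_gt S None -> chain S k v s -> i.+1 < k -> v k \in S (s i) ->
  prec (S (s i)) (v k) (v i).
Proof.
move=> g [iv is_ st] ik vk.
have /and3P[vi vi1 /eqP ei] := st i (ltnW ik).
rewrite /prec vk vi /=.
case: (ltnP (index (v i.+1) (S (s i))) (index (v k) (S (s i)))) => [lt|le].
  exfalso; apply: (g (k - i) isT).
  apply: (@bridge_nat _ _ _ _ (fun j => v (i.+1 + j))
            (fun j => if j < (k - i).-1 then s (i.+1 + j) else s i)).
  - lia.
  - by move=> a b ha hb /iv e; have := e ltac:(lia) ltac:(lia); lia.
  - move=> a b ha hb; case: ifP => ha'; case: ifP => hb' e; try lia.
    + by have := is_ _ _ _ _ e; lia.
    + by have := is_ _ _ _ _ e; lia.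
    + by have := is_ _ _ _ _ e; lia.
  - move=> j hj; have -> : j < (k - i).-1 by lia.
    by rewrite addnS; apply/follows_prec/st; lia.
  - rewrite ltnn addn0; have -> : i.+1 + (k - i).-1 = k by lia.
    by rewrite /prec vi1 vk lt.
have ne1 : index (v k) (S (s i)) <> index (v i.+1) (S (s i)).
  by move=> e0; have /iv e := index_inj (v k) vk vi1 e0; have := e ltac:(lia) ltac:(lia); lia.
have ne2 : index (v k) (S (s i)) <> index (v i) (S (s i)).
  by move=> e0; have /iv e := index_inj (v k) vk vi e0; have := e ltac:(lia) ltac:(lia); lia.
lia.
Qed.

(** Here [v k] precedes [v i] on [s i] and [v j] on [s j]. Jumping along [s i] from [v k] straight
    to [v i.+1], then following the chain to [v j], gives a bridge closed by [s j]. *)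
Lemma exit_labels_inside n p (S : path_system n p) k v s i j :
  girth_gt S None -> chain S k v s -> i < j -> j.+1 < k ->
  v k \in S (s i) -> v k \in S (s j) -> False.
Proof.
move=> g ch ij jk vi vj.
have pi := exit_label_inside g ch (ltac:(lia) : i.+1 < k) vi.
have pj := exit_label_inside g ch jk vj.
case: ch => iv is_ st.
apply: (g (j - i).+1 isT).
apply: (@bridge_nat _ _ _ _ (fun a => if a is a'.+1 then v (i.+1 + a') else v k)
         (fun a => s (i + a))) => //.
- move=> [|a] [|b] /= ha hb // /iv e;
    by first [lia | have := e ltac:(lia) ltac:(lia); lia].
- by move=> a b ha hb /is_ e; have := e ltac:(lia) ltac:(lia); lia.
- move=> [|a] /= ha.
  + rewrite !addn0; have /and3P[a1 a2 /eqP a3] := st i ltac:(lia).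
    by case/and3P: pi => b1 b2 b3; rewrite /prec b1 a2 a3 ltnS ltnW.
  + rewrite addSn -addnS; have := st (i + a.+1) ltac:(lia).
    by rewrite -addSn => /follows_prec.
- rewrite /=; have -> : i + (j - i) = j by lia.
  have -> // : (if j - i is a'.+1 then v (i.+1 + a') else v k) = v j.
  by case e : (j - i) => [|a]; [lia | congr v; lia].
Qed.

Lemma chain_extend n p (S : path_system n p) k v s :
  ps_valid S -> girth_gt S None -> chain S k v s ->
  3 < #|[set i | nonlast (S i) (v k)]| ->
  exists v' s', chain S k.+1 v' s' /\ v' k = v k.
Proof.
move=> vS g ch; have [iv is_ st] := ch.
have [[t [w [nt wt nw]]] _|noext] := pselect (exists t w,
  [/\ forall j, j < k -> s j <> t, follows (S t) (v k) w
   & forall j, j <= k -> v j <> w]).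
  exists (fun j => if j <= k then v j else w),
    (fun j => if j < k then s j else t).
  rewrite leqnn; split=> //; split.
  - move=> i j hi hj; case: ifP => ik; case: ifP => jk; first exact: iv.
    + by move=> /(nw _ ik).
    + by move=> /esym /(nw _ jk).
    + lia.
  - move=> i j hi hj; case: ifP => ik; case: ifP => jk; first exact: is_.
    + by move=> /(nt _ ik).
    + by move=> /esym /(nt _ jk).
    + lia.
  - move=> j; rewrite ltnS => jk; rewrite jk; case: ltnP => jk'; first exact: st.
    by have -> : j = k by lia.
rewrite ltnNge => /negP[].
set L := [set i | _].
set F := [set s (nat_of_ord j) | j in 'I_k].
have FP t : reflect (exists2 j, j < k & t = s j) (t \in F).
  apply: (iffP imsetP) => [[j _ ->]|[j jk ->]]; first by exists j.
  by exists (Ordinal jk).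
have c1 : #|L :\: F| <= 1.
  have ex t : t \in L :\: F -> (forall j, j < k -> s j <> t) /\
      exists2 j, j < k & prec (S t) (v k) (v j).
    rewrite !inE => /andP[/FP tF nl].
    have nt j : j < k -> s j <> t by move=> jk e; apply: tF; exists j.
    split=> //.
    have [w ft] := nonlast_follows (vS t) nl.
    apply: contrapT => nj; apply: noext; exists t, w; split=> // j jk e.
    have jk' : j < k.
      rewrite ltn_neqAle jk andbT; apply/eqP=> ejk.
      by move: (follows_prec ft); rewrite -e ejk /prec ltnn !andbF.
    by apply: nj; exists j => //; rewrite e; apply: follows_prec.
  apply/card_le1_eqP => t t' /ex [nt [j jk pj]] /ex [nt' [j' jk' pj']].
  case: (leqP j j') => jj.
    by apply/esym/(exit_labels_outside g ch _ nt nt' pj pj'); rewrite jj.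
  by apply: (exit_labels_outside g ch _ nt' nt pj' pj); rewrite (ltnW jj).
(* The label [s k.-1] is set aside because [v k] lies on it by construction. *)
have c2 : #|(L :&: F) :\ s k.-1| <= 1.
  have ex t : t \in (L :&: F) :\ s k.-1 ->
      exists2 j, j.+1 < k & t = s j /\ v k \in S (s j).
    rewrite !inE => /and3P[ne /andP[vk _] /FP[j jk e]]; subst t.
    exists j; last by split.
    have [//|kj] := ltnP j.+1 k; case/eqP: ne; congr s; lia.
  apply/card_le1_eqP => t t' /ex [j jk [-> vj]] /ex [j' jk' [-> vj']].
  have [jj|jj|-> //] := ltngtP j j'; exfalso.
    exact: exit_labels_inside g ch jj jk' vj vj'.
  exact: exit_labels_inside g ch jj jk vj' vj.
have := cardsID F L.
have := cardsD1 (s k.-1) (L :&: F).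
by case: (s k.-1 \in _); lia.
Qed.

(** Otherwise chains extend forever inside [A], but one with [n] steps already has [n.+1] distinct
    nodes. *)
Lemma exists_few_nonlast n p (S : path_system n p) (A : {set 'I_n}) x :
  ps_valid S -> girth_gt S None -> (forall i, {subset S i <= A}) -> x \in A ->
  exists2 v, v \in A & #|[set i | nonlast (S i) v]| <= 3.
Proof.
move=> vS g SA xA; apply: contrapT => no.
have many v : v \in A -> 3 < #|[set i | nonlast (S i) v]|.
  by move=> vA; rewrite ltnNge; apply/negP => le; apply: no; exists v.
have [i0 _] : exists i, i \in [set i | nonlast (S i) x].
  by apply/card_gt0P; apply: leq_trans (many x xA).
have chs k : exists v s, chain S k v s /\ v k \in A.
  elim: k => [|k [v [s [ch vA]]]].
    by exists (fun=> x), (fun=> i0); split=> //; split=> // i j; lia.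
  have [v' [s' [ch' e]]] := chain_extend vS g ch (many _ vA).
  exists v', s'; split=> //; case: ch' => _ _ /(_ k (leqnn _)) /and3P[_ + _].
  exact: SA.
have [v [s [[iv _ _] _]]] := chs n.
have inj : injective (fun i : 'I_n.+1 => v i).
  by move=> i j /(iv _ _ (ltn_ord i : i <= n) (ltn_ord j : j <= n)) /val_inj.
by have := leq_card _ inj; rewrite !card_ord ltnn.
Qed.

(** * Passing to a ranked subsystem *)

Lemma girth_gt_subseq n p (S T : path_system n p) :
  ps_valid S -> (forall i, subseq (T i) (S i)) ->
  girth_gt S None -> girth_gt T None.
Proof.
move=> vS sub g b _ [v [s [b0 iv is_ st cl]]]; apply: (g b isT).
by exists v, s; split=> // [i j e|i j e e']; apply: prec_subseq (sub _) _; auto.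
Qed.

Lemma prec_rcons n (s : seq 'I_n) a x y : a \notin s ->
  prec (rcons s a) x y = prec s x y || ((x \in s) && (y == a)).
Proof.
move=> as_; rewrite /prec !mem_rcons !inE -!cats1 !index_cat /=.
have [->|xa] := eqVneq x a; have [->|ya] := eqVneq y a;
  rewrite ?(negbTE as_) ?eqxx ?andbF ?orbF //=.
- by rewrite ltnn.
- by case: ifP => //= ys; apply/negbTE; rewrite -leqNgt addn0 ltnW ?index_mem.
- by case: ifP => //= xs; rewrite addn0 index_mem xs.
- by case: ifP => //= _; case: ifP.
Qed.

Lemma rcons_last n (s : seq 'I_n) v : uniq s -> v \in s -> ~~ nonlast s v ->
  s = rcons [seq x <- s | x != v] v.
Proof.
case/lastP: s => // s w; rewrite rcons_uniq mem_rcons inE => /andP[ws us].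
have [e _ _|vw /= vs] := eqVneq v w.
  subst w; rewrite filter_rcons eqxx /=; congr rcons; apply/esym/all_filterP/allP.
  by move=> x xs; apply: contraNneq ws => <-.
rewrite /nonlast mem_rcons inE vs orbT size_rcons -cats1 index_cat vs.
by rewrite ltnS index_mem vs.
Qed.

Definition ranked n p (T : path_system n p) (r : 'I_n -> nat) : Prop :=
  forall i x y, prec (T i) x y -> r x < r y.

(** A node [v] that is not final on at most three paths is deleted, the rest is treated recursively,
    and [v] is put back at the end of the paths where it was final. *)
Lemma acyclic_subsystem_in n p k (A : {set 'I_n}) (S : path_system n p) :
  #|A| = k -> ps_valid S -> girth_gt S None -> (forall i, {subset S i <= A}) ->
  exists (T : path_system n p) (r : 'I_n -> nat),
    [/\ forall i, subseq (T i) (S i), ranked T r, forall x, x \in A -> r x < k &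
        ps_size S <= ps_size T + 3 * k].
Proof.
elim: k A S => [|k IH] A S cA vS g SA.
  have A0 x : x \in A = false by rewrite (cards0_eq cA) inE.
  exists S, (fun=> 0); split=> // [i x y|x|]; last by rewrite muln0 addn0.
    by case/and3P => /SA; rewrite A0.
  by rewrite A0.
have [x xA] : exists x, x \in A by apply/card_gt0P; rewrite cA.
have [v vA v3] := exists_few_nonlast vS g SA xA.
pose S' i := [seq x <- S i | x != v].
have subS' i : subseq (S' i) (S i) by apply: filter_subseq.
have S'A i : {subset S' i <= A :\ v}.
  by move=> y; rewrite mem_filter !inE => /andP[-> /SA].
have [|i||T' [r' [subT' rT' r'k szT']]] := IH (A :\ v) S' _ _ _ S'A.
- by have := cardsD1 v A; rewrite vA cA => -[].
- by rewrite filter_uniq.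
- exact: girth_gt_subseq g.
have T'A i y : y \in T' i -> y \in A :\ v by move/(mem_subseq (subT' i))/S'A.
have vT' i : v \notin T' i by apply/negP => /T'A; rewrite !inE eqxx.
pose lastv i := (v \in S i) && ~~ nonlast (S i) v.
(* The recursive ranks are below [k], so rank [k] puts [v] above all other nodes of [A]. *)
exists (fun i => if lastv i then rcons (T' i) v else T' i),
  (fun y => if y == v then k else r' y); split.
- move=> i; case: ifP => [/andP[vi li]|_].
    rewrite [X in subseq _ X](rcons_last (vS i) vi li) -!cats1.
    exact: cat_subseq (subT' i) (subseq_refl _).
  exact: subseq_trans (subT' i) (subS' i).
- move=> i y z; have main : prec (T' i) y z ->
      (if y == v then k else r' y) < (if z == v then k else r' z).
    move=> pyz; have /and3P[yT zT _] := pyz.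
    have := T'A _ _ yT; have := T'A _ _ zT; rewrite !inE.
    by move=> /andP[/negbTE-> _] /andP[/negbTE-> _]; apply: rT' pyz.
  case: ifP => // _; rewrite prec_rcons // => /orP[//|/andP[yT /eqP->]].
  rewrite eqxx; have yA := T'A _ _ yT; have := r'k _ yA.
  by move: yA; rewrite !inE => /andP[/negbTE-> _].
- move=> y yA; case: eqVneq => // yv; apply: ltnW; rewrite ltnS.
  by apply: r'k; rewrite !inE yv.
- set T := fun i => if lastv i then _ else _.
  (* Compared path by path, one node is lost exactly where [v] is present but not final. *)
  suff : ps_size S + ps_size T' <= ps_size T + ps_size S' + 3 by lia.
  apply: leq_trans (leq_add (leqnn _) v3).
  rewrite -sum1dep_card big_mkcond /ps_size -!big_split /=.
  apply: leq_sum => i _; rewrite /T /S' /lastv.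
  have [vi|vi] := boolP (v \in S i); last first.
    have -> : [seq y <- S i | y != v] = S i.
      by apply/all_filterP/allP => y yS; apply: contraNneq vi => <-.
    by rewrite addnC leq_addr.
  have sz : size (S i) = (size [seq y <- S i | y != v]).+1.
    by rewrite -rem_filter // size_rem // prednK //; case: (S i) vi.
  by case: ifP => /=; rewrite ?size_rcons sz; case: nonlast => //= _; lia.
Qed.

Lemma acyclic_subsystem n p (S : path_system n p) :
  ps_valid S -> girth_gt S None ->
  exists (T : path_system n p) (r : 'I_n -> nat),
    [/\ ps_valid T, girth_gt T None, ranked T r & ps_size S <= ps_size T + 3 * n].
Proof.
move=> vS g.
have [||T [r [sub rT _ sz]]] := @acyclic_subsystem_in n p n setT S _ vS g _.
- by rewrite cardsT card_ord.
- by move=> i y _; rewrite inE.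
exists T, r; split=> //; last exact: girth_gt_subseq g.
by move=> i; apply: subseq_uniq (sub i) (vS i).
Qed.

(** * Shortcuts for the graph of a ranked bridge-free system *)

Section Ranked.
Variables (n p : nat) (T : path_system n p) (r : 'I_n -> nat).
Hypotheses (vT : ps_valid T) (gT : girth_gt T None) (rT : ranked T r).

Lemma ranked_prec i x y : x \in T i -> y \in T i -> r x < r y -> prec (T i) x y.
Proof.
move=> xi yi rxy; rewrite /prec xi yi /=.
have [//|yx|/(index_inj x xi yi) e] := ltngtP; last by rewrite e ltnn in rxy.
by have := @rT i y x; rewrite /prec xi yi yx => /(_ isT); lia.
Qed.

(** Strong induction on the length of the detour. Once its labels are distinct, its nodes are
    distinct by rank, and path [i] closes it into a bridge. *)
Lemma no_detour i m (v : nat -> 'I_n) (l : nat -> 'I_p) :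
  (forall j, j <= m -> prec (T (l j)) (v j) (v j.+1)) ->
  (forall j, j <= m -> l j <> i) -> v 0 \in T i -> v m.+1 \in T i -> False.
Proof.
elim/ltn_ind: m v l => m IH v l st li v0 vm.
have rv a b : a < b -> b <= m.+1 -> r (v a) < r (v b).
  elim: b => // b IHb; rewrite ltnS leq_eqVlt => /orP[/eqP->|ab] bm.
    by apply: rT (st b _).
  by apply: ltn_trans (IHb ab (ltnW bm)) _; apply: rT (st b _).
have [[a [b [ab bm lab]]]|inj] :=
    pselect (exists a b, [/\ a < b, b <= m & l a = l b]).
  (* a repeated label lets the detour be shortened: jump from v a to v b.+1 *)
  apply: (IH (m - (b - a)) _ (fun j => if j <= a then v j else v (j + (b - a)))
    (fun j => if j <= a then l j else l (j + (b - a)))); first lia.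
  - move=> j jm; case: (ltngtP j a) => [ja|ja|->].
    + by apply: st; lia.
    + by rewrite addSn; apply: st; lia.
    + rewrite addSn subnKC ?(ltnW ab) //; apply: ranked_prec.
      * by case/and3P: (st a ltac:(lia)).
      * by rewrite lab; case/and3P: (st b bm).
      * by apply: rv; lia.
  - by move=> j jm; case: ifP => _; apply: li; lia.
  - by [].
  - have -> : (m - (b - a)).+1 <= a = false by lia.
    by have -> : (m - (b - a)).+1 + (b - a) = m.+1 by lia.
apply: (gT (b := m.+2) isT).
apply: (@bridge_nat _ _ _ _ v (fun j => if j <= m then l j else i)) => //.
- move=> a b am bm e; have [ab|ab|//] := ltngtP a b.
    by have := rv _ _ ab bm; rewrite e ltnn.
  by have := rv _ _ ab am; rewrite e ltnn.
- move=> a b am bm; case: leqP => am'; case: leqP => bm' e.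
  + have [ab|ab|//] := ltngtP a b; exfalso; apply: inj.
      by exists a, b.
    by exists b, a.
  + by case: (li _ am').
  + by case: (li _ bm').
  + lia.
- by move=> j jm; have jm' : j <= m by []; rewrite jm'; apply: st.
- by rewrite /= ltnn; apply: ranked_prec => //; apply: rv.
Qed.

Definition step_graph : rel 'I_n := fun u v => [exists l, follows (T l) u v].

Definition step_graph_off i : rel 'I_n :=
  fun u v => [exists l, (l != i) && follows (T l) u v].

Lemma no_detour_path i x q : path (step_graph_off i) x q -> q != [::] ->
  x \in T i -> last x q \in T i -> False.
Proof.
move=> /(pathP x) pq q0 xi.
have [m em] : exists m, size q = m.+1 by case: (q) q0 => // a q' _; exists (size q').
pose v j := nth x (x :: q) j.
(* The default [i] is never taken for [j <= m], since every step of the walk has a label other than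
   [i]. *)
pose l j := odflt i [pick l | (l != i) && follows (T l) (v j) (v j.+1)].
have lP j : j <= m -> l j <> i /\ follows (T (l j)) (v j) (v j.+1).
  move=> jm; rewrite /l; case: pickP => [l' /andP[/eqP? ?] //|no].
  have /existsP[l'] := pq j ltac:(lia).
  by have := no l'; rewrite /v /= => ->.
move=> yi; apply: (@no_detour i m v l) => //.
- by move=> j /lP [_ /follows_prec].
- by move=> j /lP [].
- by rewrite /v /= -[m]/(m.+1.-1) -em nth_last.
Qed.

(** The walk is cut after its last step labelled [i]; the next lemma cuts before the first such
    step. *)
Lemma connect_off_from i x z : x \in T i -> connect step_graph x z ->
  exists2 a, a \in T i & connect (step_graph_off i) a z.
Proof.
move=> xi /connectP[q + ->]; elim/last_ind: q => [|q w IH]; first by exists x.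
rewrite rcons_path last_rcons => /andP[/IH [a ai aq] /existsP[l fl]].
have [li|li] := eqVneq l i; first by exists w => //; case/and3P: fl; rewrite li.
exists a => //; apply: connect_trans aq (connect1 _).
by apply/existsP; exists l; rewrite li.
Qed.

Lemma connect_off_to i z y : y \in T i -> connect step_graph z y ->
  exists2 c, c \in T i & connect (step_graph_off i) z c.
Proof.
move=> yi /connectP[q + e].
elim: q z e => [|w q IH] z /= e; first by exists z; rewrite // -e.
move=> /andP[/existsP[l fl] /(IH _ e) [c ci cq]].
have [li|li] := eqVneq l i; first by exists z => //; case/and3P: fl; rewrite li.
exists c => //; apply: connect_trans (connect1 _) cq.
by apply/existsP; exists l; rewrite li.
Qed.

(** The pieces around [z] that avoid label [i] join into a detour between nodes of [T i], which must
    be empty. *)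
Lemma paths_convex i x y z : x \in T i -> y \in T i ->
  connect step_graph x z -> connect step_graph z y -> z \in T i.
Proof.
move=> xi yi /(connect_off_from xi)[a ai /connectP[q1 p1 e1]].
move=> /(connect_off_to yi)[c ci /connectP[q2 p2 e2]].
case: q1 p1 e1 => [|w q1] p1 e1; first by rewrite e1.
exfalso; apply: (@no_detour_path i a ((w :: q1) ++ q2)) => //.
  by rewrite cat_path p1 -e1.
by rewrite last_cat -e1 -e2.
Qed.

Lemma connect_rank x y : connect step_graph x y -> r x <= r y.
Proof.
move=> /connectP[q + ->]; elim: q x => //= w q IH x /andP[/existsP[l fl] /IH].
by apply: leq_trans; apply/ltnW/(rT (follows_prec fl)).
Qed.

Lemma tclosure_rank x y : tclosure step_graph x y -> r x < r y.
Proof.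
case/existsP=> w /andP[/existsP[l /follows_prec/rT lt] /connect_rank].
exact: leq_trans.
Qed.

Lemma tclosure_connect x y : tclosure step_graph x y -> connect step_graph x y.
Proof. by case/existsP=> w /andP[/connect1 xw]; apply: connect_trans. Qed.

Lemma connect_along i a b x0 : a <= b -> b < size (T i) ->
  connect step_graph (nth x0 (T i) a) (nth x0 (T i) b).
Proof.
elim: b => [|b IH]; first by case: a.
rewrite leq_eqVlt => /orP[/eqP-> //|ab bs].
apply: connect_trans (IH ab (ltnW bs)) (connect1 _); apply/existsP; exists i.
by rewrite /follows !mem_nth ?(ltnW bs) // !index_uniq ?(ltnW bs) // eqxx.
Qed.

(** By rank [u] precedes [v] on [T i], and only one path contains that ordered pair, so the edge
    comes from [T i] itself. *)
Lemma step_on_path i u v : u \in T i -> v \in T i -> step_graph u v ->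
  index v (T i) = (index u (T i)).+1.
Proof.
move=> ui vi /existsP[l fl]; have pl := follows_prec fl.
have <- := two_paths_no_common_pair gT pl (ranked_prec ui vi (rT pl)).
by case/and3P: fl => _ _ /eqP.
Qed.

(** By convexity the walk stays on [T i], where graph edges advance the index by one. Too short a
    walk therefore takes a shortcut, and the first one taken joins two nodes of [T i]. *)
Lemma shortcut_in_block i (H : {set 'I_n * 'I_n}) s q :
  (forall e, e \in H -> tclosure step_graph e.1 e.2) ->
  s \in T i -> last s q \in T i -> path (union_graph step_graph H) s q ->
  index s (T i) + size q < index (last s q) (T i) ->
  exists2 e, e \in H & prec (T i) e.1 e.2 /\
    index s (T i) <= index e.1 (T i) < index (last s q) (T i).
Proof.
move=> HE; have connU u w : union_graph step_graph H u w -> connect step_graph u w.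
  by case/orP => [/connect1 //|/HE/tclosure_connect].
elim: q s => [|w q IH] s si ti /=; first by lia.
move=> /andP[sw pq] lt.
have wt : connect step_graph w (last w q).
  elim: q w pq {IH si ti lt sw} => //= a q IHq w /andP[/connU wa /IHq].
  exact: connect_trans.
have wi := paths_convex si ti (connU _ _ sw) wt.
case/orP: sw => [sw|swH].
  have iw := step_on_path si wi sw.
  have [|e eH [pe /andP[le1 le2]]] := IH w wi ti pq; first by rewrite iw addSnnS.
  by exists e => //; split=> //; rewrite le2 andbT ltnW // -iw.
have rsw := tclosure_rank (HE _ swH).
exists (s, w) => //=; split; first exact: ranked_prec.
rewrite leqnn; have /and3P[_ _ lt1] := ranked_prec si wi rsw.
apply: leq_trans lt1 _; rewrite leqNgt; apply/negP => lt2.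
have := @rT i (last w q) w; rewrite /prec ti wi lt2 => /(_ isT).
by have := connect_rank wt; lia.
Qed.

(** The ends of a block of [D.+2] nodes are [D.+1] steps apart, so each full block contains the tail
    of a shortcut. *)
Lemma blocks_le_shortcuts i D (H : {set 'I_n * 'I_n}) :
  diam_reducing_shortcut step_graph H D ->
  size (T i) %/ D.+2 <= #|[set e in H | prec (T i) e.1 e.2]|.
Proof.
case=> HE HD; set Hi := [set e in H | _].
(* Each shortcut is charged to the block of its tail; every full block number must occur in this
   list. *)
have -> : #|Hi| = size [seq index e.1 (T i) %/ D.+2 | e <- enum Hi].
  by rewrite size_map -cardE.
rewrite -(size_iota 0 (_ %/ _)); apply: uniq_leq_size; first exact: iota_uniq.
move=> c; rewrite mem_iota add0n /= => cK.
have cD : c.+1 * D.+2 <= size (T i) by rewrite -leq_divRL.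
have x0 : 'I_n by case: (T i) cD => [|x ? _] //; rewrite mulSn.
have s1 : c * D.+2 < size (T i) by lia.
have s2 : c * D.+2 + D.+1 < size (T i) by lia.
have := connect_along x0 (leq_addr D.+1 (c * D.+2)) s2.
move=> /HD [q [sq pq lq]].
have [|||e eH [pe]] := shortcut_in_block (i := i) HE _ _ pq.
- exact: mem_nth.
- by rewrite lq mem_nth.
- by rewrite lq !index_uniq ?vT // ltn_add2l ltnS.
rewrite lq !index_uniq ?vT // => /andP[le1 le2].
apply/mapP; exists e; first by rewrite mem_enum inE eH.
apply/esym/eqP; rewrite eqn_leq leq_divRL // le1 andbT -ltnS ltn_divLR //.
by rewrite mulSn addnC; apply: leq_trans le2 _; rewrite leq_add2l.
Qed.

Lemma ranked_size_bound D : SS_ok n p D -> ps_size T <= 2 * p * D.+2.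
Proof.
move=> /(_ step_graph) [H [Hp HD]].
(* After exchanging the sums, each shortcut counts for at most one path. *)
have sumH : \sum_(i < p) #|[set e in H | prec (T i) e.1 e.2]| <= #|H|.
  under eq_bigr => i _ do rewrite -sum1dep_card big_mkcondr.
  rewrite exchange_big /= -sum1_card; apply: leq_sum => e _.
  rewrite -big_mkcond sum1dep_card; apply/card_le1_eqP => i j; rewrite !inE.
  by move=> pi pj; apply: two_paths_no_common_pair pj pi.
apply: (@leq_trans (\sum_(i < p) (#|[set e in H | prec (T i) e.1 e.2]|.+1 * D.+2))).
  apply: leq_sum => i _; apply: ltnW; rewrite -ltn_divLR // ltnS.
  exact: blocks_le_shortcuts.
rewrite -big_distrl /= leq_mul2r /=.
under eq_bigr => i _ do rewrite -addn1.
rewrite big_split /= sum1_card card_ord mul2n -addnn leq_add2r.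
exact: leq_trans sumH Hp.
Qed.

End Ranked.

(** * Bounding the number of nodes, and conclusion *)

(** The residue classes modulo [p], listed increasingly, form a ranked system of total size [n]. *)
Lemma nodes_bound n p D : 0 < p -> SS_ok n p D -> n <= 2 * p * D.+2.
Proof.
move=> p0 ok; pose T (i : 'I_p) := [seq v : 'I_n <- enum 'I_n | v %% p == i].
have TP (i : 'I_p) v : v \in T i = (v %% p == i) by rewrite mem_filter mem_enum andbT.
have vT : ps_valid T by move=> i; rewrite filter_uniq // enum_uniq.
have rT : ranked T (fun v => v).
  move=> i x y /(prec_subseq (enum_uniq _) (filter_subseq _ _)) /and3P[_ _].
  by rewrite !index_enum_ord.
have gT : girth_gt T None.
  move=> b _ [v [s [b0 iv is_ st cl]]].
  case: b v s b0 iv is_ st cl => // -[|b] v s _ iv is_ st cl.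
    by have := cl ord0 ord0 erefl erefl; rewrite /prec ltnn !andbF.
  (* The first node of a bridge lies on its first and last paths, which is impossible for disjoint
     paths. *)
  have /and3P[a1 _ _] := st ord0 (inord 1) (inordK (isT : 1 < b.+2)).
  have /and3P[a2 _ _] := cl ord0 ord_max erefl erefl.
  move: a1 a2; rewrite !TP => /eqP e1 /eqP e2.
  by have := is_ ord0 ord_max (val_inj (etrans (esym e1) e2)).
apply: leq_trans (ranked_size_bound vT gT rT ok).
rewrite /ps_size /T.
under eq_bigr => i _ do rewrite size_filter -sum1_count big_enum_cond /= big_mkcond.
rewrite exchange_big /= -[X in X <= _]card_ord -sum1_card; apply: leq_sum => v _.
by rewrite (bigD1 (Ordinal (ltn_pmod v p0))) //= eqxx.
Qed.

(** In the complete graph two distinct nodes are connected but not at distance 0. Positivity of [D]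
    lets [D.+2] be absorbed into [3 * D]. *)
Lemma SS_ok_pos n p D : 1 < n -> SS_ok n p D -> 0 < D.
Proof.
move=> n1 ok; case: D ok => // ok; exfalso.
have [H [_ [_ HD]]] := ok (fun _ _ => true).
have [[|? ?] [] // _ _ /(congr1 val)] :=
  HD (Ordinal (ltnW n1)) (Ordinal n1) (connect1 isT).
Qed.

Lemma beta_le_SS n p : 1 < n -> 0 < p -> beta n p None <= 24 * (SS n p * p).
Proof.
move=> n1 p0; rewrite /SS; case: ex_minnP => D /asboolP ok _.
rewrite /beta; case: ex_maxnP => m /asboolP [S [vS gS <-]] _.
have D0 := SS_ok_pos n1 ok.
have [T [r [vT gT rT sz]]] := acyclic_subsystem vS gS.
have b1 := ranked_size_bound vT gT rT ok.
have b2 := nodes_bound p0 ok.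
apply: leq_trans sz _; apply: leq_trans (leq_add b1 (leq_mul (leqnn 3) b2)) _.
nia.
Qed.

Theorem theorem4p23 :
  exists (c : rat) (N : nat), (0 < c)%R /\
    forall n p : nat, (0 < n)%N -> (0 < p)%N -> (N <= n)%N ->
      (c * ((beta n p None)%:R / p%:R) <= (SS n p)%:R)%R.
Proof.
(* The threshold is 2 because for [n = 1] the value of [SS] is 0, while [beta] equals [p]. *)
exists (24%:R^-1)%R, 2; split=> // n p _ p0 n2.
rewrite mulrA ler_pdivrMr ?ltr0n // mulrC ler_pdivrMr ?ltr0n //.
by rewrite -!natrM ler_nat mulnC beta_le_SS.
Qed.
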